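(* Let $0<p_1,p_2<\infty$, $\varphi_i\in\mathcal{G}_{p_i}(\mathbb{D})$ with $\varphi_i(1)=1$, $i=1,2$, and let $j\in\mathbb{N}_0$ be given. Then the norm of the compact identity operator $$\mathrm{id}_j: m^{2^{jd}}_{\varphi_1,p_1}\hookrightarrow m^{2^{jd}}_{\varphi_2,p_2}$$ satisfies $$\|\mathrm{id}_j\|=\max_{0\le\nu\le j}\frac{\varphi_2(2^\nu)}{\varphi_1(2^\nu)}$$ provided that $p_1\geq p_2$. If $p_1<p_2$, then there is a constant $c$, $0<c\leq 1$, independent of $j$, such that $$c\,\max_{0\le\nu\le j}\frac{\varphi_2(2^\nu)}{\varphi_1(2^\nu)^{p_1/p_2}}\leq\|\mathrm{id}_j\|\leq\max_{0\le\nu\le j}\frac{\varphi_2(2^\nu)}{\varphi_1(2^\nu)^{p_1/p_2}}.$$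
   Context: Let $d\geq 1$ be an integer and $\mathbb{N}_0=\{0,1,2,\dots\}$. Dyadic cubes: $Q_{j,k}=2^{-j}([0,1)^d+k)$ for $j\in\mathbb{Z}$, $k\in\mathbb{Z}^d$; in particular $Q_{-\nu,m}=2^\nu([0,1)^d+m)$, and $|Q_{-\nu,m}|=2^{\nu d}$. Put $\mathbb{D}=\{2^j: j\in\mathbb{N}_0\}$. $\mathcal{G}_p(\mathbb{D})$ is the set of all $\varphi:\mathbb{D}\to(0,\infty)$ with $1\leq\frac{\varphi(2^k)}{\varphi(2^j)}\leq 2^{(k-j)d/p}$ for all $j\leq k$, $j,k\in\mathbb{N}_0$. For $0<p<\infty$, $j\in\mathbb{N}_0$, $\varphi\in\mathcal{G}_p(\mathbb{D})$, put $\mathcal{K}_j=\{k\in\mathbb{Z}^d: Q_{0,k}\subset Q_{-j,0}\}$ and let $m^{2^{jd}}_{\varphi,p}$ be the ($2^{jd}$-dimensional) space of all $\lambda=\{\lambda_k\}_{k\in\mathcal{K}_j}\subset\mathbb{C}$ equipped with the (quasi-)norm $$\|\lambda|m^{2^{jd}}_{\varphi,p}\|=\sup_{Q_{-\nu,m}\subset Q_{-j,0}}\varphi(2^\nu)\Big(|Q_{-\nu,m}|^{-1}\sum_{k:\,Q_{0,k}\subset Q_{-\nu,m}}|\lambda_k|^p\Big)^{1/p},$$ where the supremum is taken over all $\nu\in\mathbb{N}_0$ and $m\in\mathbb{Z}^d$ with $Q_{-\nu,m}\subset Q_{-j,0}$. $\|\mathrm{id}_j\|$ denotes the operator (quasi-)norm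 $\sup\{\|\lambda|m^{2^{jd}}_{\varphi_2,p_2}\|:\|\lambda|m^{2^{jd}}_{\varphi_1,p_1}\|\leq 1\}$. *)

(* Defs.v *)
From HB Require Import structures.
From mathcomp Require Import all_boot all_order all_algebra.
From mathcomp Require Import all_classical all_reals all_analysis.
From mathcomp Require Import complex.
Import Order.TTheory GRing.Theory Num.Theory.
Import numFieldNormedType.Exports.

Set Implicit Arguments.
Unset Strict Implicit.
Unset Printing Implicit Defensive.

Local Open Scope classical_set_scope.
Local Open Scope ring_scope.

(* Q_{j,k} = 2^{-j} ([0,1)^d + k). *)
Definition dyadic_cube (R : realType) (d : nat) (j : int) (k : 'rV[int]_d) :
    set 'rV[R]_d :=
  [set ((2%:R : R) ^ (- j)) *: (y + map_mx intr k) |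
    y in [set y : 'rV[R]_d | forall i, 0 <= y ord0 i < 1]].
Arguments dyadic_cube R {d} j k.

(* phi stands for a function on D = {2^j : j in N}; only its values at the
   points 2 ^+ k are ever used. *)
Definition Gclass (R : realType) (d : nat) (p : R) (phi : R -> R) : Prop :=
  (forall k : nat, 0 < phi (2 ^+ k)) /\
  (forall j k : nat, (j <= k)%N ->
     1 <= phi (2 ^+ k) / phi (2 ^+ j) <=
       2 `^ ((k%:R - j%:R) * d%:R / p)).

Definition Kset (R : realType) (d j : nat) : set 'rV[int]_d :=
  [set k | dyadic_cube R 0 k `<=` dyadic_cube R (- j%:Z) 0].
Arguments Kset : clear implicits.

Definition mspace (R : realType) (d j : nat) : Type := Kset R d j -> R[i].
Arguments mspace : clear implicits.

HB.instance Definition _ (R : realType) (d j : nat) :=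
  GRing.Zmodule.copy (mspace R d j) (Kset R d j -> R[i]).

(* The factor (2 ^+ (nu * d))^-1 is |Q_{-nu,m}|^{-1}.  The inner sum is over a
   finite set, so that the finitely supported sum is the intended one. *)
Definition mnorm (R : realType) (d : nat) (phi : R -> R) (p : R) (j : nat)
    (lam : mspace R d j) : \bar R :=
  ereal_sup
    [set (phi (2 ^+ num.1) *
          ((2 ^+ (num.1 * d))^-1 *
           \sum_(k \in [set k : Kset R d j |
                   dyadic_cube R 0 (val k) `<=`
                   dyadic_cube R (- num.1%:Z) num.2])
              ComplexField.Normc.normc (lam k) `^ p) `^ p^-1)%:E |
      num in [set num : nat * 'rV[int]_d |
        dyadic_cube R (- num.1%:Z) num.2 `<=` dyadic_cube R (- j%:Z) 0]].
Arguments mnorm {R} d phi p j lam.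

Definition opnorm (R : realType) (U V : Type)
    (N1 : U -> \bar R) (N2 : V -> \bar R) (T : U -> V) : \bar R :=
  ereal_sup [set N2 (T u) | u in [set u | (N1 u <= 1)%E]].

Definition compact_operator (R : realType) (U : Type) (V : zmodType)
    (N1 : U -> \bar R) (N2 : V -> \bar R) (T : U -> V) : Prop :=
  forall u : nat -> U,
    (exists M : R, forall n, (N1 (u n) <= M%:E)%E) ->
    exists2 f : nat -> nat, increasing_seq f &
      exists v : V, N2 (T (u (f n)) - v) @[n --> \oo] --> 0%E.

Definition id_emb (R : realType) (d j : nat) : mspace R d j -> mspace R d j :=
  idfun.
Arguments id_emb : clear implicits.

(* max_{0 <= nu <= j} F nu, for positive F. *)
Definition max_upto (R : realType) (j : nat) (F : nat -> R) : R :=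
  \big[Num.max/0]_(0 <= nu < j.+1) F nu.

(* Main.v *)
Require Import Defs.
From HB Require Import structures.
From mathcomp Require Import all_boot all_order all_algebra.
From mathcomp Require Import all_classical all_reals all_analysis.
From mathcomp Require Import complex.
From mathcomp Require Import zify ring lra.
Import Order.TTheory GRing.Theory Num.Theory.
Import numFieldNormedType.Exports.
Local Open Scope classical_set_scope.
Local Open Scope ring_scope.

(** Everything rests on two elementary facts about power means over a dyadic
    cube.  By [dyadic_cube_sub], inclusion of dyadic cubes is a pair of integer
    inequalities in each coordinate, so the [2 ^ (nu * d)] unit cubes inside
    [Q_{-nu,m}] are indexed by the finite type [cell d nu].  A bound [M] on
    [mnorm] then says that [phi (2 ^ nu)] times the power mean of the moduli
    over each such cube is at most [M] ([mnorm_le]).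

    Upper bounds.  Suppose the source norm of [lam] is at most 1, so that the
    [p1]-mean of [lam] over a cube of level [nu] is at most
    [1 / phi1 (2 ^ nu)].  If [p2 <= p1], power means increase with the exponent
    ([le_pmean]), which gives the ratio [phi2 / phi1].  If [p1 <= p2], the unit
    cubes and [phi1 1 = 1] show that every modulus is at most 1, hence
    [|lam k| ^ p2 <= |lam k| ^ p1], and the [p2]-mean is at most the [p1]-mean
    to the power [p1 / p2] ([pmean_le_powR]).

    Lower bounds.  The test sequence is [a] times the indicator of the lattice
    [2 ^ s Z^d] inside [Q_{-nu0,0}], where [nu0] attains the maximum.  A cube of
    level [nu] contains at most [2 ^ ((nu - s) * d)] such lattice points when
    [s <= nu], at most one when [nu <= s], and never more than
    [2 ^ ((nu0 - s) * d)].  Together with the two growth conditions of [Gclass]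
    this yields a source norm at most 1 as soon as [a <= 1] and
    [(a * phi1 (2 ^ nu0)) ^ p1 <= 2 ^ (s * d)] ([mnorm_lattice_seq_le1]).  For
    [p2 <= p1] the full cube, [s = 0] and [a = 1 / phi1 (2 ^ nu0)], is exactly
    extremal.  For [p1 < p2] one takes [a = 1] and the least admissible spacing
    [s]; rounding [s] up to an integer costs at most a factor [2 ^ d] in the
    number of points, whence the constant [2 ^ (- d / p2)], which depends
    neither on [j] nor on [phi1] and [phi2].

    Compactness is finite dimensionality: moduli are bounded by the source
    norm, so Bolzano-Weierstrass on the real and imaginary parts gives a
    coordinatewise convergent subsequence, and the target norm is at most
    [phi2 (2 ^ j)] times the largest modulus ([compact_id_emb]). *)

(** * Dyadic cubes as integer boxes *)

Lemma mem_dyadic_cube (R : realType) (d nu : nat) (m : 'rV[int]_d)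
    (x : 'rV[R]_d) :
  dyadic_cube R (- nu%:Z) m x <->
  forall i, 2 ^+ nu * (m ord0 i)%:~R <= x ord0 i < 2 ^+ nu * (m ord0 i + 1)%:~R.
Proof.
have pos : (0 : R) < 2 ^+ nu by rewrite exprn_gt0.
rewrite /dyadic_cube opprK; split.
  move=> [y /= y01 <-] i; rewrite !mxE rmorphD /=.
  have /andP[y0 y1] := y01 i.
  by rewrite /exprz ler_pM2l ?ltr_pM2l// -lerBlDr subrr y0 addrC ltrD2l.
move=> xm; exists ((2 ^+ nu)^-1 *: x - map_mx intr m); last first.
  by rewrite subrK scalerA divff ?scale1r// gt_eqF.
move=> i; rewrite !mxE; have /andP[x0 x1] := xm i.
rewrite subr_ge0 ltrBlDl mulrC ler_pdivlMr// ltr_pdivrMr// mulrC x0 /=.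
by move: x1; rewrite rmorphD /= mulrC.
Qed.

(** Both sides reduce to comparing faces: a half-open box lies in another one
    when its lower corner does and its right faces do not stick out. *)
Lemma dyadic_cube_sub (R : realType) (d nu mu : nat) (m n : 'rV[int]_d) :
  dyadic_cube R (- nu%:Z) m `<=` dyadic_cube R (- mu%:Z) n <->
  forall i, 2 ^+ mu * n ord0 i <= 2 ^+ nu * m ord0 i
         /\ 2 ^+ nu * (m ord0 i + 1) <= 2 ^+ mu * (n ord0 i + 1).
Proof.
have e (k : nat) (z : int) : (2 : R) ^+ k * z%:~R = (2 ^+ k * z)%:~R.
  by rewrite rmorphM rmorphXn.
split=> [sub i|le x].
  pose x : 'rV[R]_d := \row_i (2 ^+ nu * (m ord0 i)%:~R).
  have xm : dyadic_cube R (- nu%:Z) m x.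
    apply/mem_dyadic_cube => k; rewrite mxE lexx !e ltr_int.
    by rewrite ltr_pM2l ?exprn_gt0//; lia.
  have /mem_dyadic_cube /(_ i) := sub _ xm.
  rewrite mxE !e ler_int ltr_int => /andP[lo hi]; split => //.
  rewrite leNgt; apply/negP => hi'.
  (* the point whose i-th coordinate is the right end of the larger cube *)
  pose y : 'rV[R]_d :=
    \row_k if k == i then 2 ^+ mu * (n ord0 i + 1)%:~R else x ord0 k.
  have /sub /mem_dyadic_cube /(_ i) : dyadic_cube R (- nu%:Z) m y.
    apply/mem_dyadic_cube => k; rewrite mxE; case: eqP => [->|_].
      by rewrite !e ler_int ltr_int (ltW hi) hi'.
    by move/mem_dyadic_cube: xm; apply.
  by rewrite mxE eqxx ltxx andbF.
move=> /mem_dyadic_cube xm; apply/mem_dyadic_cube => i.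
have [lo hi] := le i; have /andP[x0 x1] := xm i.
by rewrite (le_trans _ x0) ?(lt_le_trans x1)// !e ler_int.
Qed.

Lemma Kset_mem (R : realType) (d j : nat) (k : 'rV[int]_d) :
  Kset R d j k <-> forall i, 0 <= k ord0 i < 2 ^+ j.
Proof.
rewrite /Kset /= -{1}[0 : int]/(- 0%:Z) dyadic_cube_sub.
by split=> H i; have := H i; rewrite mxE expr0; lia.
Qed.

(** A cube of side [2 ^ nu] cannot fit in one of side [2 ^ j < 2 ^ nu]; some
    coordinate must exist, hence [0 < d]. *)
Lemma cube_level_le (R : realType) (d j nu : nat) (m : 'rV[int]_d) :
  (0 < d)%N -> dyadic_cube R (- nu%:Z) m `<=` dyadic_cube R (- j%:Z) 0 ->
  (nu <= j)%N.
Proof.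
move=> d_gt0 /dyadic_cube_sub/(_ (Ordinal d_gt0)); rewrite mxE => -[lo hi].
have N0 : 0 < (2 : int) ^+ nu by rewrite exprn_gt0.
rewrite -(@ler_eXn2l int 2)//.
apply: le_trans (_ : 2 ^+ nu * (m ord0 (Ordinal d_gt0) + 1) <= _); last by lia.
have m0 : 0 <= m ord0 (Ordinal d_gt0) by rewrite -(pmulr_rge0 _ N0); lia.
by rewrite ler_peMr; lia.
Qed.

Lemma cube_le (R : realType) (d j nu : nat) :
  (nu <= j)%N ->
  dyadic_cube R (- nu%:Z) 0 `<=` dyadic_cube R (- j%:Z) (0 : 'rV[int]_d).
Proof.
move=> nuj; apply/dyadic_cube_sub => i; rewrite !mxE !mulr0 lexx add0r !mulr1.
by rewrite ler_eXn2l.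
Qed.

(** * Unit cubes inside a dyadic cube *)

Lemma pow2z (n : nat) : (2 ^ n)%N%:Z = 2 ^+ n.
Proof. by rewrite -natz natrX. Qed.

(** The offsets of the unit cubes of [Q_{-nu,m}] from its lower corner. *)
Definition cell (d nu : nat) := {ffun 'I_d -> 'I_(2 ^ nu)}.

Lemma card_cell (d nu : nat) : #|{: cell d nu}| = (2 ^ (nu * d))%N.
Proof. by rewrite card_ffun !card_ord expnM. Qed.

Section CellPoint.
Context {R : realType} {d j nu : nat} {m : 'rV[int]_d}.
Hypothesis sub : dyadic_cube R (- nu%:Z) m `<=` dyadic_cube R (- j%:Z) 0.

Lemma cell_point_subproof (f : cell d nu) :
  \row_i (2 ^+ nu * m ord0 i + (f i)%:Z) \in Kset R d j.
Proof.
apply/mem_set/Kset_mem => i; rewrite mxE.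
have := (dyadic_cube_sub _ _ _ _ _ _).1 sub i; rewrite mxE mulrDr.
by have := ltn_ord (f i); rewrite -ltz_nat pow2z; lia.
Qed.

Definition cell_point (f : cell d nu) : Kset R d j :=
  SigSub (cell_point_subproof f).

Lemma cell_point_bij :
  set_bij [set: cell d nu]
    [set k : Kset R d j |
      dyadic_cube R 0 (val k) `<=` dyadic_cube R (- nu%:Z) m] cell_point.
Proof.
split.
- move=> f _ /=; rewrite -[0 : int]/(- 0%:Z).
  apply/dyadic_cube_sub => i; rewrite mxE.
  by have := ltn_ord (f i); rewrite -ltz_nat pow2z expr0; lia.
- move=> f g _ _ fg; apply/ffunP => i; apply/val_inj => /=.
  by have /rowP/(_ i) := congr1 val fg; rewrite /= !mxE; lia.
move=> [k kK] /=; rewrite -[0 : int]/(- 0%:Z) => /dyadic_cube_sub km.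
have lt i : (absz (k ord0 i - 2 ^+ nu * m ord0 i)%R < 2 ^ nu)%N.
  by rewrite -ltz_nat pow2z; have := km i; rewrite expr0 mulrDr; lia.
exists [ffun i => Ordinal (lt i)] => //; apply/val_inj/rowP => i.
rewrite /= mxE ffunE /= gez0_abs; first by rewrite addrC subrK.
by have := km i; rewrite expr0; lia.
Qed.

(** Turns the sum over unit cubes into one over a finite type, where
    cardinalities are available. *)
Lemma fsum_cell_point (F : Kset R d j -> R) :
  \sum_(k \in [set k : Kset R d j |
      dyadic_cube R 0 (val k) `<=` dyadic_cube R (- nu%:Z) m]) F k =
  \sum_f F (cell_point f).
Proof.
rewrite (reindex_fsbig _ _ _ _ cell_point_bij).
rewrite [RHS]fsbig_seq ?index_enum_uniq//; congr (\sum_(_ \in _) _).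
by apply/seteqP; split => f //= _; rewrite mem_index_enum.
Qed.
End CellPoint.

(** * Power means *)

Definition pmean {R : realType} {I : finType} (p : R) (x : I -> R) : R :=
  (#|I|%:R^-1 * \sum_i x i `^ p) `^ p^-1.

Lemma powRV (R : realType) (x s : R) : 0 <= x -> x^-1 `^ s = (x `^ s)^-1.
Proof. by move=> x0; rewrite -[x^-1]powR_inv1// powRAC powR_inv1 ?powR_ge0. Qed.

Section PMean.
Context {R : realType} {I : finType}.
Implicit Types (p q : R) (x : I -> R).

Lemma pmean_ge0 p x : 0 <= pmean p x.
Proof. exact: powR_ge0. Qed.

Lemma pmean_powR p x : p != 0 -> pmean p x `^ p = #|I|%:R^-1 * \sum_i x i `^ p.
Proof.
move=> p0; rewrite -powRrM mulVf// powRr1// mulr_ge0// sumr_ge0// => i _.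
exact: powR_ge0.
Qed.

(** Trades the root for a power on the other side; the later comparisons of
    means are comparisons of such averages. *)
Lemma pmean_leP p x M : 0 < p -> 0 <= M ->
  reflect (pmean p x <= M) (#|I|%:R^-1 * \sum_i x i `^ p <= M `^ p).
Proof.
move=> p0 M0; rewrite -pmean_powR ?gt_eqF//.
have [le|lt] := leP (pmean p x) M.
  by rewrite ge0_ler_powR ?nnegrE ?pmean_ge0 ?(ltW p0)//; constructor.
have : M `^ p < pmean p x `^ p by rewrite gt0_ltr_powR ?nnegrE ?pmean_ge0.
by rewrite ltNge => /negbTE ->; constructor.
Qed.

Lemma pmean_le_max p x M : 0 < p -> (0 < #|I|)%N ->
  (forall i, 0 <= x i <= M) -> pmean p x <= M.
Proof.
move=> p0 /[dup] I0 /card_gt0P[i0 _] xM.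
have M0 : 0 <= M by have /andP[] := xM i0; apply: le_trans.
apply/pmean_leP => //; rewrite ler_pdivrMl ?ltr0n// mulr_natl -sumr_const.
apply: ler_sum => i _; have /andP[? ?] := xM i.
by rewrite ge0_ler_powR ?nnegrE// ltW.
Qed.

Lemma pmean_card1 p x i : p != 0 -> #|I| = 1%N -> 0 <= x i -> pmean p x = x i.
Proof.
move=> p0 I1 xi; have /fintype1P[i0 Ei] : #|I| == 1%N by apply/eqP.
rewrite /pmean I1 invr1 mul1r (bigD1 i)//=.
rewrite big1 => [|k]; last by rewrite !Ei eqxx.
by rewrite addr0 -powRrM divff// powRr1.
Qed.

(** Bernoulli's inequality: [a ^ r] lies above its tangent at 1.  It is Young's
    inequality for [a * 1]. *)
Lemma le_powR_tangent (a r : R) :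
  0 <= a -> 1 <= r -> a <= a `^ r / r + (1 - r^-1).
Proof.
move=> a0; rewrite le_eqVlt => /predU1P[<-|r1].
  by rewrite powRr1// invr1 subrr addr0 mulr1.
have r0 : 0 < r by lra.
have r10 : 0 < r - 1 by lra.
have q : r^-1 + (r / (r - 1))^-1 = 1 by field; rewrite !gt_eqF.
have := conjugate_powR a0 ler01 r0 (divr_gt0 r0 r10) q.
have -> : 1 - r^-1 = (r / (r - 1))^-1.
  by rewrite -[X in X - _]q addrAC subrr add0r.
by rewrite mulr1 powR1 div1r.
Qed.

(** Jensen's inequality for [t ^ (p / q)], obtained by averaging the tangent
    bound.  Comparing with a positive [M] instead of [pmean p x] avoids
    dividing by a mean that may vanish. *)
Lemma le_pmean p q x M : 0 < q <= p -> 0 < M -> (forall i, 0 <= x i) ->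
  pmean p x <= M -> pmean q x <= M.
Proof.
move=> /andP[q0 qp] M0 x0; have p0 := lt_le_trans q0 qp.
move=> /pmean_leP -/(_ p0 (ltW M0)) pM; apply/pmean_leP => //; first exact: ltW.
have Mp : 0 < M `^ p by rewrite powR_gt0.
have Mq : 0 < M `^ q by rewrite powR_gt0.
have [I0|I0] := posnP #|I|.
  by rewrite I0 invr0 mul0r ltW.
have le i : x i `^ q <= M `^ q * (q / p * (x i `^ p / M `^ p) + (1 - q / p)).
  have xM : 0 <= x i / M by rewrite divr_ge0// ltW.
  rewrite -ler_pdivrMl//.
  have := @le_powR_tangent ((x i / M) `^ q) (p / q) (powR_ge0 _ _) _.
  rewrite ler_pdivlMr// mul1r => /(_ qp).
  rewrite -powRrM mulrC [q * _]mulrC divfK ?gt_eqF// invf_div.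
  rewrite !powRM ?invr_ge0 ?(ltW M0)// !powRV ?(ltW M0)//.
  by rewrite [_ * (q / p)]mulrC [(M `^ p)^-1 * _]mulrC.
apply: (@le_trans _ _ (#|I|%:R^-1 *
    \sum_i M `^ q * (q / p * (x i `^ p / M `^ p) + (1 - q / p)))).
  by rewrite ler_pM2l ?invr_gt0 ?ltr0n//; apply: ler_sum.
rewrite -mulr_sumr big_split/= -mulr_sumr -mulr_suml sumr_const.
set S := \sum_i _; rewrite -[X in _ + X]mulr_natr.
have -> : #|I|%:R^-1 * (M `^ q * (q / p * (S / M `^ p) + (1 - q / p) * #|I|%:R)) =
    M `^ q * (q / p * (#|I|%:R^-1 * S / M `^ p) + (1 - q / p)).
  by field; rewrite !gt_eqF ?ltr0n.
rewrite ler_piMr ?(ltW Mq)// addrCA gerDl subr_le0.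
by rewrite ler_piMr ?divr_ge0 ?(ltW q0) ?(ltW p0)// ler_pdivrMr ?mul1r.
Qed.

(** The reverse comparison holds for values in the unit interval, since
    [t ^ q <= t ^ p] there. *)
Lemma pmean_le_powR p q x M : 0 < p <= q -> 0 <= M ->
  (forall i, 0 <= x i <= 1) -> pmean p x <= M -> pmean q x <= M `^ (p / q).
Proof.
move=> /andP[p0 pq] M0 x01; have q0 := lt_le_trans p0 pq.
move=> /pmean_leP -/(_ p0 M0) pM; apply/pmean_leP; rewrite ?powR_ge0//.
rewrite -powRrM divfK ?gt_eqF//; apply: le_trans pM.
rewrite ler_wpM2l ?invr_ge0//; apply: ler_sum => i _.
have /andP[] := x01 i; rewrite le_eqVlt => /predU1P[<-|xi0] xi1.
  by rewrite !powR0 ?gt_eqF.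
by rewrite ger_powR ?xi0.
Qed.
End PMean.

(** * Moduli, and the norm as a supremum of power means *)

Lemma normc_le_ReIm (R : realType) (z : R[i]) :
  ComplexField.Normc.normc z <= `|complex.Re z| + `|complex.Im z|.
Proof.
case: z => a b /=; rewrite -[leRHS]ger0_norm ?addr_ge0// -sqrtr_sqr ler_wsqrtr//.
by rewrite sqrrD !real_normK ?num_real// lerD2r lerDl mulrn_wge0// mulr_ge0.
Qed.

Lemma ReIm_le_normc (R : realType) (z : R[i]) :
  `|complex.Re z| <= ComplexField.Normc.normc z /\
  `|complex.Im z| <= ComplexField.Normc.normc z.
Proof.
by case: z => a b /=; rewrite -!sqrtr_sqr !ler_wsqrtr ?lerDl ?lerDr ?sqr_ge0.
Qed.

Lemma normc_ge0 (R : realType) (z : R[i]) : 0 <= ComplexField.Normc.normc z.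
Proof. by case: z => a b; rewrite sqrtr_ge0. Qed.

Section MnormCells.
Context {R : realType} {d j : nat}.
Variables (phi : R -> R) (p : R) (lam : mspace R d j).
Local Notation normc := ComplexField.Normc.normc.

Let cube_meanE (nu : nat) (m : 'rV[int]_d)
    (sub : dyadic_cube R (- nu%:Z) m `<=` dyadic_cube R (- j%:Z) 0) :
  ((2 ^+ (nu * d))^-1 * \sum_(k \in [set k : Kset R d j |
     dyadic_cube R 0 (val k) `<=` dyadic_cube R (- nu%:Z) m])
     normc (lam k) `^ p) `^ p^-1 =
  pmean p (fun f : cell d nu => normc (lam (cell_point sub f))).
Proof. by rewrite (fsum_cell_point sub) /pmean card_cell natrX. Qed.

Lemma pmean_le_mnorm (nu : nat) (m : 'rV[int]_d)
    (sub : dyadic_cube R (- nu%:Z) m `<=` dyadic_cube R (- j%:Z) 0) :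
  ((phi (2 ^+ nu) * pmean p (fun f : cell d nu =>
      normc (lam (cell_point sub f))))%:E <= mnorm d phi p j lam)%E.
Proof. by apply: ereal_sup_ubound; exists (nu, m) => //=; rewrite cube_meanE. Qed.

(** Reduces every upper bound on the norm to power means over finite types. *)
Lemma mnorm_le (M : R) :
  (mnorm d phi p j lam <= M%:E)%E <->
  forall (nu : nat) (m : 'rV[int]_d)
    (sub : dyadic_cube R (- nu%:Z) m `<=` dyadic_cube R (- j%:Z) 0),
    phi (2 ^+ nu) * pmean p (fun f : cell d nu =>
      normc (lam (cell_point sub f))) <= M.
Proof.
split=> [le nu m sub|le]; first by rewrite -lee_fin (le_trans _ le) ?pmean_le_mnorm.
apply: ge_ereal_sup => _ [[nu m] /= sub <-].
by rewrite lee_fin (cube_meanE _ _ sub).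
Qed.
End MnormCells.

(** * Growth of the weights, and the maximum over levels *)

(** The growth condition raised to the power [p]: it says that
    [2 ^ (nu * d) / phi (2 ^ nu) ^ p] is nondecreasing in [nu], a form free of
    real exponents of 2. *)
Lemma Gclass_powR_le (R : realType) (d : nat) (p : R) (phi : R -> R)
    (j k : nat) :
  0 < p -> Gclass d p phi -> (j <= k)%N ->
  phi (2 ^+ k) `^ p <= phi (2 ^+ j) `^ p * 2 ^+ ((k - j) * d).
Proof.
move=> p0 [phi0 G] jk; have /andP[_ le] := G _ _ jk.
rewrite ler_pdivrMr// in le.
have ge0 n : 0 <= phi (2 ^+ n) by rewrite ltW.
apply: (le_trans (ge0_ler_powR (ltW p0) _ _ le)).
- by rewrite nnegrE ge0.
- by rewrite nnegrE mulr_ge0 ?powR_ge0.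
rewrite powRM ?powR_ge0// -powRrM divfK ?gt_eqF//.
by rewrite -natrB// -natrM powR_mulrn// mulrC.
Qed.

Lemma Gclass_le (R : realType) (d : nat) (p : R) (phi : R -> R) (j k : nat) :
  Gclass d p phi -> (j <= k)%N -> phi (2 ^+ j) <= phi (2 ^+ k).
Proof.
move=> [phi0 G] jk; have /andP[le _] := G _ _ jk.
by rewrite ler_pdivlMr ?mul1r in le.
Qed.

Lemma le_max_upto (R : realType) (j : nat) (F : nat -> R) (nu : nat) :
  (nu <= j)%N -> F nu <= max_upto j F.
Proof.
move=> nuj; rewrite /max_upto big_mkord.
exact: (le_bigmax _ (fun i : 'I_j.+1 => F i) (Ordinal (nuj : (nu < j.+1)%N))).
Qed.

Lemma max_upto_attained (R : realType) (j : nat) (F : nat -> R) :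
  (forall nu, 0 <= F nu) -> exists2 nu, (nu <= j)%N & max_upto j F = F nu.
Proof.
move=> F0; rewrite /max_upto big_mkord (bigmax_eq_arg _ ord0)//.
by set k := (X in F X); exists k => //; rewrite -ltnS ltn_ord.
Qed.

(** * Upper bounds for the operator norm *)

Section UpperBounds.
Context {R : realType} {d j : nat} (p1 p2 : R) (phi1 phi2 : R -> R).
Hypotheses (d_gt0 : (0 < d)%N) (p1_gt0 : 0 < p1) (p2_gt0 : 0 < p2).
Hypothesis (phi1_gt0 : forall n, 0 < phi1 (2 ^+ n)).
Hypothesis (phi2_gt0 : forall n, 0 < phi2 (2 ^+ n)).
Local Notation opn :=
  (opnorm (mnorm d phi1 p1 j) (mnorm d phi2 p2 j) (id_emb R d j)).
Local Notation normc := ComplexField.Normc.normc.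

Lemma pmean_mnorm_le (M : R) (lam : mspace R d j) (nu : nat) (m : 'rV[int]_d)
    (sub : dyadic_cube R (- nu%:Z) m `<=` dyadic_cube R (- j%:Z) 0) :
  (mnorm d phi1 p1 j lam <= M%:E)%E ->
  pmean p1 (fun f : cell d nu => normc (lam (cell_point sub f))) <=
    M / phi1 (2 ^+ nu).
Proof. by move=> /mnorm_le/(_ nu m sub); rewrite ler_pdivlMr// mulrC. Qed.

(** A cube of level 0 contains a single point, and its weight is [phi1 1]. *)
Lemma normc_le_mnorm (M : R) (lam : mspace R d j) (k : Kset R d j) :
  phi1 1 = 1 -> (mnorm d phi1 p1 j lam <= M%:E)%E -> normc (lam k) <= M.
Proof.
move=> phi11 le.
have sub : dyadic_cube R (- 0%:Z) (val k) `<=` dyadic_cube R (- j%:Z) 0.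
  by have := set_valP k.
have := pmean_mnorm_le _ _ _ _ sub le.
rewrite expr0 phi11 divr1.
pose f : cell d 0 := [ffun _ => ord0].
rewrite (@pmean_card1 _ _ _ _ f) ?gt_eqF ?normc_ge0 ?card_cell//.
suff -> : cell_point sub f = k by [].
apply/val_inj/rowP => i; rewrite /= mxE ffunE expr0 mul1r/=; exact: addr0.
Qed.

Lemma opnorm_le_ratio : p2 <= p1 ->
  (opn <= (max_upto j (fun nu => phi2 (2 ^+ nu) / phi1 (2 ^+ nu)))%:E)%E.
Proof.
move=> p21; apply: ge_ereal_sup => _ [lam /= lam1 <-].
apply/mnorm_le => nu m sub.
apply: (@le_trans _ _ (phi2 (2 ^+ nu) / phi1 (2 ^+ nu))); last first.
  apply: (@le_max_upto _ _ (fun nu => phi2 (2 ^+ nu) / phi1 (2 ^+ nu))).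
  exact: cube_level_le sub.
rewrite ler_pM2l//; apply: (@le_pmean _ _ p1).
- by rewrite p2_gt0.
- by rewrite invr_gt0.
- by move=> f; exact: normc_ge0.
- by rewrite -div1r; exact: pmean_mnorm_le.
Qed.

Lemma opnorm_le_powR_ratio : p1 <= p2 -> phi1 1 = 1 ->
  (opn <= (max_upto j
     (fun nu => phi2 (2 ^+ nu) / phi1 (2 ^+ nu) `^ (p1 / p2)))%:E)%E.
Proof.
move=> p12 phi11; apply: ge_ereal_sup => _ [lam /= lam1 <-].
apply/mnorm_le => nu m sub.
set F := (X in max_upto j X).
apply: (@le_trans _ _ (F nu)); last first.
  by apply: le_max_upto; exact: cube_level_le sub.
rewrite /F ler_pM2l// -powRV ?(ltW (phi1_gt0 _))//.
apply: pmean_le_powR.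
- by rewrite p1_gt0.
- by rewrite invr_ge0 ltW.
- by move=> f; rewrite normc_ge0 (normc_le_mnorm _ _ _ phi11 lam1).
- by rewrite -div1r; exact: pmean_mnorm_le.
Qed.

End UpperBounds.

(** * Counting lattice points in dyadic cubes *)

(** Multiples of [2 ^ s] are determined modulo [2 ^ r] by their quotients
    modulo [2 ^ (r - s)], so reduced quotients can count lattice points. *)
Lemma eq_mod_pow2 (s t r q q' : nat) : (r <= s + t)%N ->
  q = q' %[mod 2 ^ t] -> (q * 2 ^ s = q' * 2 ^ s %[mod 2 ^ r])%N.
Proof.
move=> rst /(congr1 (muln (2 ^ s))); rewrite !muln_modr -!expnD.
rewrite ![(_ * 2 ^ s)%N]mulnC.
move=> e; have dv : (2 ^ r %| 2 ^ (s + t))%N by rewrite dvdn_exp2l.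
by rewrite -(modn_dvdm _ dv) e modn_dvdm.
Qed.

(** One coordinate of the lattice points of [2 ^ s Z^d] lying both in
    [Q_{-nu0,0}] and in a cube of level [nu] with index [c]. *)
Definition lattice_residues (s nu0 nu c : nat) : pred 'I_(2 ^ nu) :=
  fun a => (2 ^ nu * c + a < 2 ^ nu0)%N && (2 ^ s %| 2 ^ nu * c + a)%N.

(** The two alternatives bound the count by the size of the cube of level [nu]
    and by that of [Q_{-nu0,0}].  With [t = nu - s] truncated, the first also
    covers [nu < s], where at most one point is left. *)
Lemma card_lattice_residues_le (s nu0 nu c t : nat) :
  (nu <= s + t)%N || (nu0 <= s + t)%N ->
  (#|lattice_residues s nu0 nu c| <= 2 ^ t)%N.
Proof.
move=> st; set A := lattice_residues s nu0 nu c.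
have t0 : (0 < 2 ^ t)%N by rewrite expn_gt0.
pose q (a : 'I_(2 ^ nu)) : 'I_(2 ^ t) :=
  Ordinal (ltn_pmod ((2 ^ nu * c + a) %/ 2 ^ s) t0).
rewrite -[leqRHS]card_ord; apply: (@leq_card_in _ _ q).
move=> a b /andP[a0 sa] /andP[b0 sb] /(congr1 val) /= e; apply/val_inj => /=.
move: st => /orP[st|st].
all: have := eq_mod_pow2 _ _ _ _ _ st e; rewrite !divnK//.
  by move=> /eqP; rewrite eqn_modDl !modn_small// => /eqP.
by rewrite !modn_small// => /addnI.
Qed.

Lemma card_lattice_residues0 (s nu : nat) : (s <= nu)%N ->
  (#|lattice_residues s nu nu 0| = 2 ^ (nu - s))%N.
Proof.
move=> snu; apply/eqP; rewrite eqn_leq card_lattice_residues_le ?subnKC ?leqnn//=.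
have lt (b : 'I_(2 ^ (nu - s))) : (2 ^ s * b < 2 ^ nu)%N.
  by rewrite -{2}(subnKC snu) expnD ltn_pmul2l ?expn_gt0.
pose g b := Ordinal (lt b).
have g_inj : injective g.
  move=> a b /(congr1 val) /= /eqP; rewrite eqn_pmul2l ?expn_gt0// => /eqP.
  exact: val_inj.
rewrite -[leqLHS]card_ord -(card_codom g_inj).
apply/subset_leq_card/fintype.subsetP.
move=> _ /codomP[b ->]; rewrite unfold_in /lattice_residues /= muln0 add0n lt.
by rewrite dvdn_mulr.
Qed.

(** * The test sequences *)

Section LatticeSequence.
Context {R : realType} {d j : nat} (s nu0 : nat) (a : R).
Local Notation normc := ComplexField.Normc.normc.

(** Coordinates in [Kset] are nonnegative, so [absz] is only a cast to [nat]. *)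
Definition lattice_seq : mspace R d j := fun k =>
  if [forall i, (absz (val k ord0 i) < 2 ^ nu0)%N &&
                (2 ^ s %| absz (val k ord0 i))%N] then a%:C%C else 0.

Hypothesis a_ge0 : 0 <= a.

Lemma pmean_lattice_seq (p : R) (nu : nat) (m : 'rV[int]_d)
    (sub : dyadic_cube R (- nu%:Z) m `<=` dyadic_cube R (- j%:Z) 0) : 0 < p ->
  pmean p (fun f : cell d nu => normc (lattice_seq (cell_point sub f))) =
  ((2 ^+ (nu * d))^-1 *
   ((\prod_(i < d) #|lattice_residues s nu0 nu (absz (m ord0 i))|)%N%:R * a `^ p))
   `^ p^-1.
Proof.
move=> p0; rewrite /pmean card_cell natrX; congr ((_ * _) `^ _).
have m0 i : 0 <= m ord0 i.
  have := (dyadic_cube_sub _ _ _ _ _ _).1 sub i; rewrite mxE mulr0 => -[+ _].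
  by rewrite pmulr_rge0 ?exprn_gt0.
have absE (f : cell d nu) i :
    absz (val (cell_point sub f) ord0 i) = (2 ^ nu * absz (m ord0 i) + f i)%N.
  by rewrite /= mxE -pow2z; have := m0 i; lia.
pose P := family (fun i => lattice_residues s nu0 nu (absz (m ord0 i))).
transitivity (\sum_(f : cell d nu | f \in P) a `^ p).
  rewrite [RHS]big_mkcond; apply: eq_bigr => f _; rewrite /lattice_seq.
  under eq_forallb => i do rewrite absE.
  case: ifPn => [/forallP Pf|/forallP Pf].
    rewrite ifT; last by apply/familyP.
    by rewrite /= expr0n addr0 sqrtr_sqr ger0_norm.
  rewrite ifF; first by rewrite ComplexField.Normc.normc0 powR0 ?gt_eqF.
  by apply/negP => /familyP.
rewrite sumr_const -[LHS]mulr_natl card_family; congr (_%:R * _).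
by rewrite foldrE big_image.
Qed.

Lemma prod_card_lattice_residues_le (nu t : nat) (m : 'rV[int]_d) :
  (nu <= s + t)%N || (nu0 <= s + t)%N ->
  (\prod_(i < d) #|lattice_residues s nu0 nu (absz (m ord0 i))|)%N%:R <=
    2 ^+ (t * d) :> R.
Proof.
move=> st; rewrite -natrX ler_nat expnM.
rewrite -[X in (_ <= _ ^ X)%N]card_ord -prod_nat_const.
by apply: leq_prod => i _; exact: card_lattice_residues_le.
Qed.

(** A cube at least as large as [Q_{-nu0,0}] may contain all lattice points, and the growth
    condition of [Gclass] from [nu0] to [nu] absorbs its volume.  In a smaller
    cube with [s <= nu] the lattice is equidistributed and monotonicity of
    [phi] suffices.  A cube with [nu < s] has at most one point, and
    [phi (2 ^ nu) ^ p <= 2 ^ (nu * d)]. *)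
Lemma mnorm_lattice_seq_le1 (phi : R -> R) (p : R) :
  0 < p -> Gclass d p phi -> phi 1 = 1 -> a <= 1 -> (s <= nu0)%N ->
  (a * phi (2 ^+ nu0)) `^ p <= 2 ^+ (s * d) ->
  (mnorm d phi p j lattice_seq <= 1%:E)%E.
Proof.
move=> p0 G phi1 a1 snu0 aphi; have [phi_gt0 _] := G.
have phi_ge0 n : 0 <= phi (2 ^+ n) by rewrite ltW.
have pow_ge0 n : 0 <= 2 ^+ n :> R by rewrite exprn_ge0.
apply/mnorm_le => nu m sub; rewrite pmean_lattice_seq//.
set n := (\prod_(i < d) _)%N.
set A := a `^ p; have A0 : 0 <= A := powR_ge0 _ _.
have key : phi (2 ^+ nu) `^ p * (n%:R * A) <= 2 ^+ (nu * d).
  rewrite powRM// -/A in aphi.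
  have [nu0nu|nunu0] := leqP nu0 nu.
    have nle : n%:R <= 2 ^+ ((nu0 - s) * d) :> R.
      by apply: prod_card_lattice_residues_le; rewrite subnKC// leqnn orbT.
    apply: (@le_trans _ _ ((phi (2 ^+ nu0) `^ p * 2 ^+ ((nu - nu0) * d)) *
                           (2 ^+ ((nu0 - s) * d) * A))).
      apply: ler_pM; rewrite ?powR_ge0 ?mulr_ge0//; first exact: Gclass_powR_le.
      exact: ler_wpM2r.
    rewrite (_ : nu * d = s * d + ((nu - nu0) * d + (nu0 - s) * d))%N; last first.
      by rewrite -!mulnDl; congr muln; lia.
    rewrite exprD exprD [leLHS](_ : _ = A * phi (2 ^+ nu0) `^ p *
      (2 ^+ ((nu - nu0) * d) * 2 ^+ ((nu0 - s) * d))); last by ring.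
    by apply: ler_wpM2r; rewrite ?mulr_ge0.
  have [snu|nus] := leqP s nu.
    have nle : n%:R <= 2 ^+ ((nu - s) * d) :> R.
      by apply: prod_card_lattice_residues_le; rewrite subnKC// leqnn.
    apply: (@le_trans _ _ (phi (2 ^+ nu0) `^ p * (2 ^+ ((nu - s) * d) * A))).
      apply: ler_pM; rewrite ?powR_ge0 ?mulr_ge0//; last exact: ler_wpM2r.
      by rewrite ge0_ler_powR ?nnegrE ?(ltW p0) ?(Gclass_le _ _ _ _ _ _ G) 1?ltnW.
    rewrite (_ : nu * d = s * d + (nu - s) * d)%N; last by rewrite -mulnDl subnKC.
    rewrite exprD [leLHS](_ : _ = A * phi (2 ^+ nu0) `^ p * 2 ^+ ((nu - s) * d)).
      exact: ler_wpM2r.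
    by ring.
  have nle : n%:R <= 1 :> R.
    rewrite -[leRHS](expr0 2); apply: (prod_card_lattice_residues_le nu 0).
    by rewrite addn0 ltnW.
  have := Gclass_powR_le _ _ _ _ _ _ p0 G (leq0n nu).
  rewrite expr0 phi1 powR1 mul1r subn0; apply: le_trans.
  rewrite ler_piMr ?powR_ge0// mulr_ile1//.
  apply: (@le_trans _ _ (1 `^ p)); last by rewrite powR1.
  by rewrite ge0_ler_powR ?nnegrE ?(ltW p0).
have -> : phi (2 ^+ nu) = (phi (2 ^+ nu) `^ p) `^ p^-1.
  by rewrite -powRrM divff ?gt_eqF// powRr1.
apply: (@le_trans _ _ (1 `^ p^-1)); last by rewrite powR1.
have X0 : 0 <= n%:R * A by rewrite mulr_ge0.
rewrite -powRM ?powR_ge0 ?mulr_ge0 ?invr_ge0//.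
rewrite ge0_ler_powR ?nnegrE ?invr_ge0 ?(ltW p0) ?mulr_ge0 ?powR_ge0 ?invr_ge0//.
by rewrite mulrCA ler_pdivrMl ?exprn_gt0// mulr1.
Qed.

Lemma le_opnorm_lattice_seq (phi1 phi2 : R -> R) (p1 p2 : R) :
  0 < p1 -> 0 < p2 -> Gclass d p1 phi1 -> phi1 1 = 1 -> a <= 1 ->
  (s <= nu0)%N -> (nu0 <= j)%N ->
  (a * phi1 (2 ^+ nu0)) `^ p1 <= 2 ^+ (s * d) ->
  ((phi2 (2 ^+ nu0) * ((2 ^+ (s * d))^-1 `^ p2^-1 * a))%:E <=
   opnorm (mnorm d phi1 p1 j) (mnorm d phi2 p2 j) (id_emb R d j))%E.
Proof.
move=> p1_gt0 p2_gt0 G phi11 a1 snu0 nu0j aphi.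
apply: (@le_trans _ _ (mnorm d phi2 p2 j lattice_seq)); last first.
  apply: ereal_sup_ubound; exists lattice_seq => //=.
  exact: mnorm_lattice_seq_le1 aphi.
have sub :
    dyadic_cube R (- nu0%:Z) 0 `<=` dyadic_cube R (- j%:Z) (0 : 'rV[int]_d).
  exact: cube_le.
apply: le_trans (pmean_le_mnorm phi2 p2 lattice_seq nu0 0 sub).
rewrite pmean_lattice_seq// lee_fin.
under eq_bigr => i _ do rewrite mxE card_lattice_residues0//.
rewrite prod_nat_const card_ord -expnM natrX.
have -> : (2 ^+ (nu0 * d))^-1 * (2 ^+ ((nu0 - s) * d) * a `^ p2) =
    (2 ^+ (s * d))^-1 * a `^ p2.
  have -> : (nu0 * d = s * d + (nu0 - s) * d)%N by rewrite -mulnDl subnKC.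
  by rewrite exprD; field; rewrite !expf_neq0.
rewrite powRM ?invr_ge0 ?exprn_ge0 ?powR_ge0//.
by rewrite -powRrM divff ?gt_eqF// powRr1.
Qed.

End LatticeSequence.

(** * Lower bounds for the operator norm *)

Section LowerBounds.
Context {R : realType} {d : nat} (p1 p2 : R) (phi1 phi2 : R -> R).
Hypotheses (p1_gt0 : 0 < p1) (p2_gt0 : 0 < p2).
Hypotheses (G1 : Gclass d p1 phi1) (G2 : Gclass d p2 phi2) (phi11 : phi1 1 = 1).
Local Notation opn j :=
  (opnorm (mnorm d phi1 p1 j) (mnorm d phi2 p2 j) (id_emb R d j)).

Let phi1_gt0 n : 0 < phi1 (2 ^+ n). Proof. exact: G1.1. Qed.
Let phi2_gt0 n : 0 < phi2 (2 ^+ n). Proof. exact: G2.1. Qed.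

(** Spacing [s = 0]: the constant [1 / phi1 (2 ^ nu)] on the whole of
    [Q_{-nu,0}]. *)
Lemma ratio_le_opnorm (j : nat) :
  ((max_upto j (fun nu => phi2 (2 ^+ nu) / phi1 (2 ^+ nu)))%:E <= opn j)%E.
Proof.
have [|nu nuj ->] := @max_upto_attained R j
    (fun nu => phi2 (2 ^+ nu) / phi1 (2 ^+ nu)).
  by move=> ?; rewrite divr_ge0 ?ltW.
have a1 : (phi1 (2 ^+ nu))^-1 <= 1.
  rewrite invf_le1//.
  by have := Gclass_le _ _ _ _ _ _ G1 (leq0n nu); rewrite expr0 phi11.
have a0 : 0 <= (phi1 (2 ^+ nu))^-1 by rewrite invr_ge0 ltW.
have := @le_opnorm_lattice_seq R d j 0 nu _ a0 phi1 phi2 p1 p2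
  p1_gt0 p2_gt0 G1 phi11 a1 (leq0n _) nuj.
rewrite mulVf ?gt_eqF// mul0n expr0 !powR1 invr1 powR1 mul1r; exact.
Qed.

(** Height 1 and the least [s] with [phi1 (2 ^ nu) ^ p1 <= 2 ^ (s * d)].  By
    minimality [2 ^ (s * d)] overshoots by at most a factor [2 ^ d]. *)
Lemma powR_ratio_le_opnorm (j : nat) :
  (((2 ^+ d)^-1 `^ p2^-1 * max_upto j
     (fun nu => phi2 (2 ^+ nu) / phi1 (2 ^+ nu) `^ (p1 / p2)))%:E <= opn j)%E.
Proof.
have [|nu nuj ->] := @max_upto_attained R j
    (fun nu => phi2 (2 ^+ nu) / phi1 (2 ^+ nu) `^ (p1 / p2)).
  by move=> ?; rewrite divr_ge0 ?powR_ge0 ?ltW.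
set Phi := phi1 (2 ^+ nu) `^ p1; have Phi_gt0 : 0 < Phi by rewrite powR_gt0.
have ex : exists s, Phi <= 2 ^+ (s * d).
  exists nu; have := Gclass_powR_le _ _ _ _ _ _ p1_gt0 G1 (leq0n nu).
  by rewrite expr0 phi11 powR1 mul1r subn0.
case: (ex_minnP ex) => s sPhi s_min.
have snu : (s <= nu)%N.
  apply: s_min; have := Gclass_powR_le _ _ _ _ _ _ p1_gt0 G1 (leq0n nu).
  by rewrite expr0 phi11 powR1 mul1r subn0.
(* minimality of s, where s = 0 only needs 1 <= Phi *)
have sPhi' : 2 ^+ (s * d) <= 2 ^+ d * Phi.
  case: s s_min {sPhi snu} => [_|s s_min].
    have Phi1 : 1 <= Phi.
      rewrite -(powRr0 (phi1 (2 ^+ nu))) ler_powR ?(ltW p1_gt0)//.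
      by have := Gclass_le _ _ _ _ _ _ G1 (leq0n nu); rewrite expr0 phi11.
    by rewrite mul0n expr0 -[leLHS]mulr1 ler_pM// exprn_ege1// ler1n.
  rewrite mulSn exprD ler_pM2l ?exprn_gt0// leNgt; apply/negP => /ltW/s_min.
  by rewrite ltnn.
have := @le_opnorm_lattice_seq R d j s nu 1 ler01 phi1 phi2 p1 p2
  p1_gt0 p2_gt0 G1 phi11 (lexx _) snu nuj.
rewrite mul1r mulr1 => /(_ sPhi); apply: le_trans; rewrite lee_fin.
rewrite mulrCA ler_pM2l// powRrM -/Phi -powRV ?(ltW Phi_gt0)//.
rewrite -powRM ?invr_ge0 ?exprn_ge0 ?(ltW Phi_gt0)//.
rewrite ge0_ler_powR ?nnegrE ?mulr_ge0 ?invr_ge0 ?exprn_ge0 ?(ltW Phi_gt0)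
  ?(ltW p2_gt0)//.
by rewrite -invfM lef_pV2 ?posrE ?mulr_gt0 ?exprn_gt0.
Qed.
End LowerBounds.

(** * Compactness *)

Lemma increasing_seq_ge (g : nat -> nat) (n : nat) :
  increasing_seq g -> (n <= g n)%N.
Proof.
move=> /increasing_seqP g_inc; elim: n => // n IH.
exact: leq_ltn_trans IH (g_inc n).
Qed.

Lemma increasing_seq_cvg_oo (g : nat -> nat) :
  increasing_seq g -> g n @[n --> \oo] --> \oo.
Proof.
move=> g_inc A [N _ NA]; exists N => // n /= Nn; apply: NA => /=.
exact: leq_trans Nn (increasing_seq_ge _ _ g_inc).
Qed.

(** Coordinates are treated one after the other: passing to a further
    subsequence keeps the limits already obtained. *)
Lemma bolzano_weierstrass_fin (R : realType) (I : finType)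
    (u : nat -> I -> R) (M : R) :
  (forall n i, `|u n i| <= M) ->
  exists2 f : nat -> nat, increasing_seq f &
    forall i, cvgn (fun n => u (f n) i).
Proof.
move=> uM.
suff [f f_inc fs] : exists2 f : nat -> nat, increasing_seq f &
    forall i, i \in enum I -> cvgn (fun n => u (f n) i).
  by exists f => // i; apply: fs; rewrite mem_enum.
elim: (enum I) => [|x s [f f_inc fs]]; first by exists id.
have [|g g_inc gx] := @bolzano_weierstrass R (fun n => u (f n) x).
  exists M; split; first exact: num_real.
  by move=> y My n _ /=; rewrite (le_trans (uM _ _))// ltW.
exists (f \o g) => [m n|i]; first by rewrite /= f_inc; exact: g_inc.
rewrite inE => /predU1P[->//|/fs /cvg_ex[l ul]].
apply/cvg_ex; exists l.
exact: (cvg_comp _ _ (increasing_seq_cvg_oo _ g_inc) ul).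
Qed.

Lemma compact_id_emb (R : realType) (d j : nat) (p1 p2 : R)
    (phi1 phi2 : R -> R) :
  (0 < d)%N -> 0 < p1 -> 0 < p2 ->
  (forall k, 0 < phi1 (2 ^+ k)) -> phi1 1 = 1 -> Gclass d p2 phi2 ->
  compact_operator (mnorm d phi1 p1 j) (mnorm d phi2 p2 j) (id_emb R d j).
Proof.
move=> d_gt0 p1_gt0 p2_gt0 phi1_gt0 phi11 G2 u [M uM].
have sub :
    dyadic_cube R (- j%:Z) 0 `<=` dyadic_cube R (- j%:Z) (0 : 'rV[int]_d) by [].
pose pt := cell_point sub.
have pt_surj k : exists f, pt f = k.
  have [_ _ /(_ k) []] := cell_point_bij sub; first exact: set_valP k.
  by move=> f _ <-; exists f.
(* the real (true) and imaginary (false) parts of all coordinates *)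
pose w n (c : cell d j * bool) : R :=
  if c.2 then complex.Re (u n (pt c.1)) else complex.Im (u n (pt c.1)).
have wM n c : `|w n c| <= M.
  have le := @normc_le_mnorm R d j p1 phi1 p1_gt0 phi1_gt0 M (u n) (pt c.1)
    phi11 (uM n).
  have [re im] := ReIm_le_normc _ (u n (pt c.1)).
  by rewrite /w; case: ifP => _; apply: le_trans le.
have [f f_inc fw] := bolzano_weierstrass_fin _ _ _ _ wM.
exists f => //.
have [q qpt] := choice pt_surj.
pose l c := limn (fun n => w (f n) c).
pose v : mspace R d j := fun k => Complex (l (q k, true)) (l (q k, false)).
exists v.
pose e n := \sum_c `|w (f n) c - l c|.
have e0 : e n @[n --> \oo] --> 0.
  have -> : 0 = \sum_(c : cell d j * bool) (0 : R) by rewrite big1.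
  apply: cvg_big => [|c _]; first exact: add_continuous.
  rewrite -(normr0 R); apply: cvg_norm; rewrite -(subrr (l c)).
  by apply: cvgB; [exact: fw|exact: cvg_cst].
have uv n k : ComplexField.Normc.normc ((u (f n) - v) k) <= e n.
  apply: (le_trans (normc_le_ReIm _ _)).
  have subk : (u (f n) - v) k = u (f n) k - v k by [].
  have re : complex.Re ((u (f n) - v) k) = w (f n) (q k, true) - l (q k, true).
    by rewrite subk /w /= qpt /v; case: (u (f n) k).
  have im : complex.Im ((u (f n) - v) k) = w (f n) (q k, false) - l (q k, false).
    by rewrite subk /w /= qpt /v; case: (u (f n) k).
  rewrite re im /e (bigD1 (q k, true))//= (bigD1 (q k, false)) /=; last first.
    by rewrite xpair_eqE andbF.
  by rewrite addrA lerDl sumr_ge0.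
have N2 n : (mnorm d phi2 p2 j (u (f n) - v)%R <= (phi2 (2 ^+ j) * e n)%:E)%E.
  apply/mnorm_le => nu m s.
  have phi2_gt0 : 0 < phi2 (2 ^+ nu) by apply: G2.1.
  apply: ler_pM; rewrite ?pmean_ge0 ?(ltW phi2_gt0)//.
    by apply: Gclass_le G2 _; exact: cube_level_le s.
  apply: pmean_le_max; rewrite ?card_cell ?expn_gt0// => c.
  by rewrite normc_ge0 /= uv.
apply: (@squeeze_cvge _ _ _ _ (fun=> 0%E) _ (fun n => (phi2 (2 ^+ j) * e n)%:E)).
- apply: nearW => n; rewrite N2 andbT.
  apply: le_trans (pmean_le_mnorm phi2 p2 _ j 0 sub).
  by rewrite lee_fin mulr_ge0 ?pmean_ge0// ltW// G2.1.
- exact: cvg_cst.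
apply/fine_cvgP; split; first exact: nearW.
rewrite -[0%R](mulr0 (phi2 (2 ^+ j))); apply: cvgMl_tmp; exact: e0.
Qed.

(** * The norm of the identity *)

Theorem proposition4p2 (R : realType) (d : nat) (p1 p2 : R) (phi1 phi2 : R -> R)
  (hd : (1 <= d)%N) (hp1 : 0 < p1) (hp2 : 0 < p2)
  (hphi1 : Gclass d p1 phi1) (hphi2 : Gclass d p2 phi2)
  (hphi11 : phi1 1 = 1) (hphi21 : phi2 1 = 1) :
  [/\ forall j : nat,
        compact_operator (mnorm d phi1 p1 j) (mnorm d phi2 p2 j)
          (id_emb R d j),
      p2 <= p1 -> forall j : nat,
        opnorm (mnorm d phi1 p1 j) (mnorm d phi2 p2 j) (id_emb R d j) =
        (max_upto j (fun nu => phi2 (2 ^+ nu) / phi1 (2 ^+ nu)))%:E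
    & p1 < p2 -> exists c : R, 0 < c <= 1 /\ forall j : nat,
        ((c * max_upto j
            (fun nu => phi2 (2 ^+ nu) / phi1 (2 ^+ nu) `^ (p1 / p2)))%:E
         <= opnorm (mnorm d phi1 p1 j) (mnorm d phi2 p2 j)
              (id_emb R d j)
         <= (max_upto j
            (fun nu => phi2 (2 ^+ nu) / phi1 (2 ^+ nu) `^ (p1 / p2)))%:E)%E].
Proof.
have G1_gt0 := hphi1.1; have G2_gt0 := hphi2.1.
split=> [j|p21 j|p12].
- exact: compact_id_emb.
- apply/eqP; rewrite eq_le opnorm_le_ratio//=.
  exact: ratio_le_opnorm.
exists ((2 ^+ d)^-1 `^ p2^-1); split=> [|j].
  rewrite powR_gt0 ?invr_gt0 ?exprn_gt0//=.
  apply: (@le_trans _ _ (1 `^ p2^-1)); last by rewrite powR1.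
  rewrite ge0_ler_powR ?nnegrE ?invr_ge0 ?(ltW hp2) ?exprn_ge0//.
  by rewrite invf_le1 ?exprn_ege1 ?exprn_gt0 ?ler1n.
rewrite powR_ratio_le_opnorm//=.
by apply: opnorm_le_powR_ratio => //; exact: ltW.
Qed.
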